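(* Let $N\ge 2$ be a prime, let $\{b_k\}_{k=1}^\infty$ be a sequence of integers with $|b_k|\ge 2$, let $\{t_k\}_{k=1}^\infty$ be a bounded sequence of integers with $|t_k|\ge 1$, and let $D_k=\{0,1,\dots,N-1\}\,t_k$ for $k\ge1$. Let $$\mu_{\{b_k\},\{D_k\}}=\delta_{b_1^{-1}D_1}\ast\delta_{b_1^{-1}b_2^{-1}D_2}\ast\delta_{b_1^{-1}b_2^{-1}b_3^{-1}D_3}\ast\cdots$$ and let $\mathbf{s}_k=\tau_N(b_1b_2\cdots b_k)-\tau_N(Nt_k)$ for $k\ge 1$. If $\mu_{\{b_k\},\{D_k\}}$ is a spectral measure, then $\mathbf{s}_i\ne\mathbf{s}_j$ for all $i\ne j\in\mathbb{N}^+$, and $$D_n\oplus b_nD_{n-1}\oplus b_nb_{n-1}D_{n-2}\oplus\cdots\oplus b_nb_{n-1}\cdots b_2D_1$$ is an integer tile for all $n\in\mathbb{N}^+$ (in particular, these sums are direct).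
   Context: For a finite set $E\subset\mathbb{R}$, $\delta_E=\frac{1}{\#E}\sum_{e\in E}\delta_e$ with $\delta_e$ the Dirac mass at $e$; $cE=\{ce:e\in E\}$; $\{0,1,\dots,N-1\}t=\{0,t,\dots,(N-1)t\}$. The infinite convolution is the weak limit of the finite convolutions $\delta_{b_1^{-1}D_1}\ast\cdots\ast\delta_{b_1^{-1}\cdots b_k^{-1}D_k}$ (it exists here and is a compactly supported Borel probability measure). A compactly supported Borel probability measure $\mu$ on $\mathbb{R}$ is a spectral measure if there is $\Lambda\subset\mathbb{R}$ (a spectrum of $\mu$) such that $\{e^{2\pi i\lambda x}:\lambda\in\Lambda\}$ is an orthogonal basis of $L^2(\mu)$. For a nonzero integer $A$, $\tau_N(A)=\max\{k\in\{0,1,2,\dots\}:N^k\mid A\}$. $A_1\oplus\cdots\oplus A_m$ denotes the sumset $A_1+\cdots+A_m$ together with the assertion that the sum is direct (unique representations). A finite set $D\subset\mathbb{Z}$ is an integer tile if there exist an integer $p\ge 1$ and $L\subset\mathbb{Z}$ with $D\oplus L=\mathbb{Z}/p\mathbb{Z}$, i.e. the sums $d+l$ represent each residue class modulo $p$ exactly once. *)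

(* Defs.v *)
From HB Require Import structures.
From mathcomp Require Import all_boot all_order all_algebra finmap.
From mathcomp Require Import complex.
From mathcomp Require Import all_classical all_reals all_analysis.
From mathcomp Require Import measurable_realfun.

Set Implicit Arguments.
Unset Strict Implicit.
Unset Printing Implicit Defensive.

Import Order.TTheory GRing.Theory Num.Theory.
Import numFieldNormedType.Exports.

Local Open Scope fset_scope.
Local Open Scope classical_set_scope.
Local Open Scope complex_scope.
Local Open Scope ring_scope.

(* [measurableTypeR R] is R with its Borel sigma-algebra. *)

(* The measure delta_E of a finite set E. For E empty it is the null measure
   (not a probability), whence the use of finite measures below. *)
Section uniform_measure.
Context (R : realType).
Local Notation B := (measurableTypeR R).

Definition delta_fset (E : {fset R}) (A : set B) : \bar R :=
  ((#|` E|%:R^-1)%:E * \sum_(e <- E) \d_(e : B) A)%E.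

Let weight_ge0 (E : {fset R}) : 0 <= (#|` E|%:R^-1 : R).
Proof. by rewrite invr_ge0. Qed.

Let delta_fsetE (E : {fset R}) :
  delta_fset E = mscale (NngNum (weight_ge0 E))
    (msum (fun i => \d_((enum_fset E)`_i : B) : {measure set B -> \bar R}) #|` E|).
Proof.
apply/funext => A; rewrite /delta_fset /mscale /msum /=.
by rewrite (big_nth 0) big_mkord.
Qed.

Section instances.
Variable E : {fset R}.

Let delta_fset0 : delta_fset E set0 = 0%E.
Proof. by rewrite delta_fsetE measure0. Qed.

Let delta_fset_ge0 A : (0 <= delta_fset E A)%E.
Proof. by rewrite delta_fsetE measure_ge0. Qed.

Let delta_fset_sigma_additive : semi_sigma_additive (delta_fset E).
Proof. by rewrite delta_fsetE; exact: measure_semi_sigma_additive. Qed.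

HB.instance Definition _ := isMeasure.Build _ _ _ (delta_fset E)
  delta_fset0 delta_fset_ge0 delta_fset_sigma_additive.

Let delta_fset_fin : fin_num_fun (delta_fset E).
Proof.
move=> A mA; rewrite /delta_fset fin_numM// sum_fin_num.
by apply/allP => _ /mapP[e _ ->]; rewrite diracE.
Qed.

HB.instance Definition _ :=
  Measure_isFinite.Build _ _ _ (delta_fset E) delta_fset_fin.

End instances.
End uniform_measure.

Section convolution.
Context (R : realType).
Local Notation B := (measurableTypeR R).
Local Notation fmeasure := {finite_measure set B -> \bar R}.

Definition convolution (m1 m2 : fmeasure) : set B -> \bar R :=
  pushforward (m1 \x m2)%E (fun x : B * B => (x.1 + x.2)%R : B).

Section instances.
Variables m1 m2 : fmeasure.

Let measurable_addB : measurable_fun setT (fun x : B * B => (x.1 + x.2)%R : B).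
Proof. by apply: measurable_funD; [exact: measurable_fst|exact: measurable_snd]. Qed.

Let convolution0 : convolution m1 m2 set0 = 0%E.
Proof. by rewrite /convolution /pushforward preimage_set0 measure0. Qed.

Let convolution_ge0 A : (0 <= convolution m1 m2 A)%E.
Proof. by apply: integral_ge0 => x _; exact: measure_ge0. Qed.

Let convolution_sigma_additive : semi_sigma_additive (convolution m1 m2).
Proof.
move=> F mF tF mUF; rewrite /convolution /pushforward preimage_bigcup.
apply: measure_semi_sigma_additive.
- by move=> n; rewrite -[X in measurable X]setTI; exact: measurable_addB.
- apply/trivIsetP => /= i j _ _ ij; rewrite -preimage_setI.
  by move/trivIsetP : tF => /(_ _ _ _ _ ij) ->//; rewrite preimage_set0.
- by rewrite -preimage_bigcup -[X in measurable X]setTI; exact: measurable_addB.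
Qed.

HB.instance Definition _ := isMeasure.Build _ _ _ (convolution m1 m2)
  convolution0 convolution_ge0 convolution_sigma_additive.

Let convolution_fin : fin_num_fun (convolution m1 m2).
Proof.
apply: lty_fin_num_fun; rewrite /= /convolution /pushforward preimage_setT.
rewrite -setXTT product_measure1E//.
by rewrite lte_mul_pinfty ?fin_num_measure// -ge0_fin_numE ?fin_num_measure.
Qed.

HB.instance Definition _ :=
  Measure_isFinite.Build _ _ _ (convolution m1 m2) convolution_fin.

End instances.

(* delta_{E 1} * ... * delta_{E n.+1} *)
Fixpoint finite_convolution (E : nat -> {fset R}) (n : nat) : fmeasure :=
  if n is m.+1 then convolution (finite_convolution E m) (delta_fset (E n.+1))
  else delta_fset (E 1%N).

Definition weakly_converges (m : nat -> fmeasure) (mu : fmeasure) : Prop :=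
  forall f : R -> R, continuous f ->
    (exists M, forall x, `|f x| <= M) ->
    (fun n => \int[m n]_x f x) @ \oo --> \int[mu]_x f x.

Definition is_infinite_convolution (E : nat -> {fset R}) (mu : fmeasure) : Prop :=
  weakly_converges (finite_convolution E) mu.

End convolution.

Section spectral.
Context (R : realType).
Local Notation B := (measurableTypeR R).
Variable mu : probability B R.

Definition compactly_supported : Prop :=
  exists2 K : set R, compact K & mu (~` K) = 0%E.

Definition cexp (l x : R) : R[i] :=
  cos (2 * pi * l * x) +i* sin (2 * pi * l * x).

(* |z|^2 as a real number *)
Definition sqnorm (z : R[i]) : R := complex.Re z ^+ 2 + complex.Im z ^+ 2.

Definition in_L2 (f : R -> R[i]) : Prop :=
  [/\ measurable_fun [set: B] (fun x : B => complex.Re (f x)),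
      measurable_fun [set: B] (fun x : B => complex.Im (f x)) &
      mu.-integrable [set: B] (fun x : B => (sqnorm (f x))%:E)].

Definition inner_L2 (f g : R -> R[i]) : R[i] :=
  (\int[mu]_x complex.Re (f x * (g x)^*)) +i*
  (\int[mu]_x complex.Im (f x * (g x)^*)).

Definition sqdist_L2 (f g : R -> R[i]) : \bar R :=
  (\int[mu]_x (sqnorm (f x - g x))%:E)%E.

(* The exponentials have norm 1 in L^2(mu), so orthogonality makes them an
   orthonormal system; it is a Hilbert basis iff its finite linear
   combinations are dense in L^2(mu). *)
Definition is_spectrum (L : set R) : Prop :=
  (forall l1 l2, L l1 -> L l2 -> l1 != l2 ->
     inner_L2 (cexp l1) (cexp l2) = 0) /\
  (forall f, in_L2 f -> forall e : R, 0 < e ->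
     exists n (l : 'I_n -> R) (c : 'I_n -> R[i]),
       (forall i, L (l i)) /\
       (sqdist_L2 f (fun x => (\sum_i c i * cexp (l i) x)%R) < e%:E)%E).

Definition spectral_measure : Prop :=
  compactly_supported /\ exists L : set R, is_spectrum L.

End spectral.

Definition digits (N : nat) (t : int) : {fset int} :=
  [fset i%:Z * t | i : nat in iota 0 N].

Definition scale_fset (K : pzRingType) (c : K) (E : {fset K}) : {fset K} :=
  [fset c * e | e in E].

Definition to_reals (R : realType) (D : {fset int}) : {fset R} :=
  [fset d%:~R | d : int in D].

(* max {k | N^k divides A}; for N >= 2 and A <> 0 such k satisfy k < |A|. *)
Definition tau (N : nat) (A : int) : nat :=
  \max_(k < `|A|.+1 | ((N ^ k)%N%:Z %| A)%Z) k.

Lemma tauE (N : nat) (A : int) : prime N -> A != 0 -> tau N A = logn N `|A|.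
Proof.
move=> pN A0; have A_gt0 : (0 < `|A|)%N by rewrite absz_gt0.
apply/eqP; rewrite eqn_leq; apply/andP; split.
  by apply/bigmax_leqP => k; rewrite dvdzE /= pfactor_dvdn.
have ltA : (logn N `|A| < `|A|.+1)%N.
  by rewrite ltnS (leq_trans (ltnW (ltn_logl N A_gt0))).
apply: (@leq_bigmax_cond _ _ (fun k : 'I_(`|A|.+1) => k : nat) (Ordinal ltA)).
by rewrite dvdzE /= pfactor_dvdn.
Qed.

Definition add_fset (A B : {fset int}) : {fset int} :=
  [fset a + b | a in A, b in B].

Definition sumset (m : nat) (A : 'I_m -> {fset int}) : {fset int} :=
  \big[add_fset/[fset 0]]_(i < m) A i.

Definition direct_sum (m : nat) (A : 'I_m -> {fset int}) : Prop :=
  forall x y : 'I_m -> int,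
    (forall i, x i \in A i) -> (forall i, y i \in A i) ->
    \sum_i x i = \sum_i y i -> x =1 y.

Definition integer_tile (D : {fset int}) : Prop :=
  exists (p : nat) (L : set int), (1 <= p)%N /\
    forall r : int, exists! dl : int * int,
      [/\ dl.1 \in D, L dl.2 & (dl.1 + dl.2 = r %[mod p])%Z].

(* Main.v *)
(* If the mask of D_k vanishes at x / (b_1 ... b_k), then x is a rational of
   N-adic valuation s_k; so distinct points of a spectrum L differ by a rational whose valuation
   is one of the s_k. Suppose s_p = s_q with p <> q. Colouring each point of L
   by its N-ary digit at level s_p (after clearing a common denominator, which
   exists because t is bounded) splits L into N classes; inside a class no
   difference has valuation s_p, so each class is orthogonal for the
   convolution with the factors p and q removed. Now test against a bump g at
   the right end of the support of mu. There the digits j_p and j_q are the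
   extremal ones, an event of probability N^-2, and by the orthogonality of the
   N classes every trigonometric polynomial with frequencies in L has at most
   N * N^-2 = 1/N of its L^2 mass on this event. Hence the distance from g to
   the span of the exponentials is at least (1 - 1/N)^(1/2) |g|, against
   completeness. All estimates are made on the finite convolutions, and only
   orthogonality and the final approximation of g pass through the weak limit.

   Once the s_k are distinct, the numbers b_n ... b_(k+1) t_k have distinct
   N-adic valuations. Choosing N^l at every other level l below m completes
   them to a mixed system of digits for Z / N^m, so the sums are direct and form
   a tile. *)

Require Import Defs.
From mathcomp Require Import all_boot all_order all_algebra finmap.
From mathcomp Require Import complex.
From mathcomp Require Import all_classical all_reals all_analysis.
From mathcomp Require Import measurable_realfun zify ring lra.

Set Implicit Arguments.
Unset Strict Implicit.
Unset Printing Implicit Defensive.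

Import Order.TTheory GRing.Theory Num.Theory.
Import numFieldNormedType.Exports.

Local Open Scope ring_scope.

(** * Mixed digit systems and tiles *)

Section tiles.
Variable (N : nat).
Hypothesis pN : prime N.

Let N_gt0 : (0 < N)%N := prime_gt0 pN.

Lemma dvdz_pfactor (c : int) (k : nat) : c != 0 ->
  ((N ^ k)%N%:Z %| c)%Z = (k <= logn N `|c|)%N.
Proof. by move=> c0; rewrite dvdzE /= pfactor_dvdn// absz_gt0. Qed.

(* A term of least valuation is not cancelled by the others. *)
Lemma sum_distinct_valuations (I : finType) (v : I -> nat) (c : I -> int) :
  injective v -> (forall k, c k != 0 -> logn N `|c k| = v k) ->
  (exists k, c k != 0) ->
  exists k, ~~ ((N ^ (v k).+1)%N%:Z %| \sum_i c i)%Z.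
Proof.
move=> vI cv [k0 ck0].
have [k ck kmin] := @arg_minnP _ k0 (fun k => c k != 0) v ck0.
exists k; rewrite (bigD1 k)//= rpredDr; last first.
  apply: rpred_sum => i ik; have [->|ci] := eqVneq (c i) 0; first exact: rpred0.
  rewrite dvdz_pfactor// cv// ltn_neqAle kmin// andbT.
  by apply: contra ik => /eqP/vI ->.
by rewrite dvdz_pfactor// cv// ltnn.
Qed.

(** Two distinct digits differ by less than N in absolute value, so their difference is prime to
    N. *)
Lemma digit_valuation (g : int) (x y : 'I_N) : g != 0 ->
  g * (x%:Z - y%:Z) != 0 -> logn N `|(g * (x%:Z - y%:Z))%R| = logn N `|g|%N.
Proof.
move=> g0; rewrite mulf_eq0 (negPf g0)/= => xy0.
rewrite abszM lognM ?absz_gt0// [X in (_ + X)%N](_ : _ = 0%N) ?addn0//.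
apply/eqP; rewrite -leqn0 leqNgt logn_gt0 mem_primes pN absz_gt0 xy0/=.
apply/negP => /dvdn_leq; rewrite absz_gt0 xy0 => /(_ isT).
by have := ltn_ord x; have := ltn_ord y; lia.
Qed.

(** In the difference of two expansions the nonzero terms have distinct valuations, so the least of
    them survives. *)
Lemma mixed_digits_inj (I : finType) (g : I -> int) (x y : I -> 'I_N) :
  (forall i, g i != 0) -> injective (fun i => logn N `|g i|%N) ->
  \sum_i g i * (x i)%:Z = \sum_i g i * (y i)%:Z -> x =1 y.
Proof.
move=> g0 vI E i; apply/eqP; apply/negPn/negP => xyi.
have [//||k] := @sum_distinct_valuations _ (fun i => logn N `|g i|%N)
    (fun i => g i * ((x i)%:Z - (y i)%:Z)) vI.
- by move=> k; exact: digit_valuation.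
- exists i; rewrite mulf_neq0// subr_eq0; apply: contra xyi => /eqP[] xy.
  exact/eqP/val_inj.
- under eq_bigr do rewrite mulrBr.
  by rewrite sumrB E subrr dvdz0.
Qed.

(** Same argument modulo N^m: the surviving term has valuation k < m, and N^(k+1) divides N^m. *)
Lemma mixed_digits_mod_inj (m : nat) (g : 'I_m -> int) (x y : 'I_m -> 'I_N) :
  (forall l, g l != 0) -> (forall l, logn N `|g l|%N = l) ->
  (\sum_l g l * (x l)%:Z = \sum_l g l * (y l)%:Z %[mod (N ^ m)%N])%Z -> x =1 y.
Proof.
move=> g0 gv E i; apply/eqP; apply/negPn/negP => xyi.
have [||k] := @sum_distinct_valuations _ (fun l : 'I_m => l : nat)
    (fun i => g i * ((x i)%:Z - (y i)%:Z)) val_inj.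
- by move=> k; rewrite -[RHS]gv; exact: digit_valuation.
- exists i; rewrite mulf_neq0// subr_eq0; apply: contra xyi => /eqP[] xy.
  exact/eqP/val_inj.
- under eq_bigr do rewrite mulrBr.
  rewrite sumrB => /negP; apply.
  apply: (@dvdz_trans (N ^ m)%N%:Z); last by rewrite -eqz_mod_dvd; exact/eqP.
  by rewrite dvdzE /= dvdn_exp2l.
Qed.

(** Counting: there are N^m digit strings and N^m residues, and the expansion is injective. *)
Lemma mixed_digits_mod_surj (m : nat) (g : 'I_m -> int) (r : int) :
  (forall l, g l != 0) -> (forall l, logn N `|g l|%N = l) ->
  exists x : 'I_m -> 'I_N, (\sum_l g l * (x l)%:Z = r %[mod (N ^ m)%N])%Z.
Proof.
move=> g0 gv; have Nm : (0 < N ^ m)%N by rewrite expn_gt0 N_gt0.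
have Nm0 : (N ^ m)%N%:Z != 0 by rewrite -lt0n.
have red (z : int) : (`|z %% (N ^ m)%N|%Z < N ^ m)%N.
  by rewrite -ltz_nat gez0_abs ?modz_ge0// ltz_pmod.
pose f (x : {ffun 'I_m -> 'I_N}) := Ordinal (red (\sum_l g l * (x l)%:Z)).
have absK (z : int) : `|(z %% (N ^ m)%N)%Z|%N%:Z = (z %% (N ^ m)%N)%Z.
  by rewrite gez0_abs// modz_ge0.
have fI : injective f.
  move=> x y [] E; apply/ffunP; apply: (mixed_digits_mod_inj g0 gv).
  by rewrite -[LHS]absK -[RHS]absK E.
have [|x xE] := codomP (inj_card_onto fI _ (Ordinal (red r))).
  by rewrite card_ffun !card_ord.
by exists x; rewrite -[LHS]absK -[RHS]absK; case: xE => ->.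
Qed.

Lemma mem_sumset (m : nat) (A : 'I_m -> {fset int}) (x : int) :
  (x \in sumset A) <->
  exists2 y : 'I_m -> int, forall i, y i \in A i & x = \sum_i y i.
Proof.
(* The induction runs over duplicate-free lists, so that the choice function can be altered at the
   head without disturbing the tail. *)
suff H (r : seq 'I_m) z : uniq r -> (z \in \big[add_fset/[fset 0]%fset]_(i <- r) A i) <->
    exists2 y : 'I_m -> int, forall i, i \in r -> y i \in A i & z = \sum_(i <- r) y i.
  rewrite /sumset H ?index_enum_uniq//; split=> -[y yA ->]; exists y => // i.
  by apply: yA; rewrite mem_index_enum.
elim: r z => [|i r IH] z /=.
  move=> _; rewrite big_nil inE; split; last by case=> y _ ->; rewrite big_nil.
  by move=> /eqP ->; exists (fun=> 0); rewrite ?big_nil.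
move=> /andP[ir ur]; rewrite big_cons; split.
  move=> /imfset2P[a /= aA [s /= sA ->]].
  have [y yA ->] := (IH s ur).1 sA.
  exists (fun k => if k == i then a else y k).
    by move=> k; rewrite inE; case: eqP => [->//|_ /=]; exact: yA.
  rewrite big_cons eqxx; congr (_ + _); rewrite !big_seq; apply: eq_bigr => k kr.
  by case: eqP kr ir => // -> ->.
move=> [y yA ->]; rewrite big_cons; apply/imfset2P => /=.
exists (y i); first by apply: yA; rewrite inE eqxx.
exists (\sum_(k <- r) y k) => //; apply/(IH _ ur); exists y => // k kr.
by apply: yA; rewrite inE kr orbT.
Qed.

Lemma mem_scaled_digits (c t x : int) :
  reflect (exists j : 'I_N, x = c * t * j%:Z) (x \in scale_fset c (digits N t)).
Proof.
apply: (iffP (imfsetP _ _ _ _)) => /= [[_ /imfsetP[j /= jN ->] ->]|[j ->]].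
  move: jN; rewrite mem_iota add0n /= => jN; exists (Ordinal jN) => /=.
  by rewrite mulrCA mulrC.
exists (j%:Z * t); last by rewrite mulrCA mulrC.
by apply/imfsetP; exists (j : nat); rewrite //= mem_iota add0n ltn_ord.
Qed.

Section scaled_digits.
Variables (n : nat) (c t : 'I_n -> int).
Let g i := c i * t i.
Let A i := scale_fset (c i) (digits N (t i)).
Hypothesis g0 : forall i, g i != 0.
Hypothesis gI : injective (fun i => logn N `|g i|%N).

Let digits_of (x : 'I_n -> int) : (forall i, x i \in A i) ->
  exists j : 'I_n -> 'I_N, forall i, x i = g i * (j i)%:Z.
Proof.
move=> xA; have jx i : exists j : 'I_N, x i == g i * j%:Z.
  by have /mem_scaled_digits[j ->] := xA i; exists j.
by exists (fun i => xchoose (jx i)) => i; apply/eqP; exact: (xchooseP (jx i)).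
Qed.

Lemma scaled_digits_direct : direct_sum A.
Proof.
move=> x y /digits_of[j xj] /digits_of[k yk] E i.
rewrite xj yk; congr (_ * (nat_of_ord _)%:Z).
apply: (mixed_digits_inj g0 gI).
by under eq_bigr do rewrite -xj; under [RHS]eq_bigr do rewrite -yk.
Qed.

(* With v_i the valuation of g_i and m > max v_i, the tile is completed to
   Z/N^m by the digits N^l at the levels l < m that are none of the v_i. *)
Lemma scaled_digits_tile : integer_tile (sumset A).
Proof.
pose m := (\max_i logn N `|g i|%N).+1.
have vm i : (logn N `|g i|%N < m)%N by rewrite ltnS; apply: leq_bigmax.
pose v i : 'I_m := Ordinal (vm i).
have vI : injective v by move=> i j [] /gI.
pose V := [set v i | i : 'I_n].
pose h (l : 'I_m) : int := if [pick i | v i == l] is Some i then g i else (N ^ l)%N%:Z.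
have hv i : h (v i) = g i.
  by rewrite /h; case: pickP => [j /eqP/vI ->//|/(_ i)]; rewrite eqxx.
have h0 l : h l != 0.
  by rewrite /h; case: pickP => // _; rewrite -lt0n expn_gt0 N_gt0.
have hl l : logn N `|h l|%N = l.
  rewrite /h; case: pickP => [i /eqP <-//|_].
  by rewrite absz_nat pfactorK.
have sumE (F : 'I_m -> int) : \sum_l F l = \sum_i F (v i) + \sum_(l in ~: V) F l.
  rewrite (bigID (mem V))/=; congr (_ + _); last by apply: eq_bigl => l; rewrite inE.
  by rewrite big_imset/=; [apply: eq_bigl|move=> ? ? _ _; exact: vI].
(* [ext j z] takes the digits j at the levels of the tile and z at the others, so that tile element
   plus complement is one expansion over all m levels. *)
pose ext (j : 'I_n -> 'I_N) (z : 'I_m -> 'I_N) l :=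
  if [pick i | v i == l] is Some i then j i else z l.
have extv j z i : ext j z (v i) = j i.
  by rewrite /ext; case: pickP => [k /eqP/vI ->//|/(_ i)]; rewrite eqxx.
have extC j z l : l \in ~: V -> ext j z l = z l.
  rewrite inE => lV; rewrite /ext; case: pickP => // i /eqP il.
  by move: lV; rewrite -il imset_f.
have sumext j z : \sum_l h l * (ext j z l)%:Z =
    \sum_i g i * (j i)%:Z + \sum_(l in ~: V) h l * (z l)%:Z.
  rewrite sumE; congr (_ + _); apply: eq_bigr => l; first by rewrite hv extv.
  by move=> lV; rewrite extC.
exists (N ^ m)%N, [set x | exists z : 'I_m -> 'I_N,
  x = \sum_(l in ~: V) h l * (z l)%:Z]%classic.
split=> [|r]; first by rewrite expn_gt0 N_gt0.
have [x xr] := mixed_digits_mod_surj r h0 hl.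
exists (\sum_i g i * (x (v i))%:Z, \sum_(l in ~: V) h l * (x l)%:Z); split=> /=.
  split=> /=; last 2 [by exists x].
  - apply/mem_sumset; exists (fun i => g i * (x (v i))%:Z) => // i.
    by apply/mem_scaled_digits; exists (x (v i)).
  - rewrite -xr sumE; congr (modz (_ + _) _).
    by apply: eq_bigr => i _; rewrite hv.
move=> [d l] /= [/mem_sumset[y /digits_of[j yj] ->] [z ->] dlr].
have E : x =1 ext j z.
  apply: (mixed_digits_mod_inj h0 hl); rewrite xr -dlr sumext.
  by under [in RHS]eq_bigr do rewrite -yj.
congr pair; apply: eq_bigr.
  by move=> i _; rewrite E extv yj.
by move=> i iV; rewrite E extC.
Qed.

End scaled_digits.
End tiles.

(** * Finite convolutions and their transforms *)

(* The expectation of f(j_1 a_1 + ... + j_n a_n) for independent digits j_k of law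
   w k; the weights need not have total mass 1. *)
Fixpoint digit_mean (R : realType) (N : nat) (a : nat -> R)
    (w : nat -> 'I_N -> R) (n : nat) (f : R -> R) : R :=
  if n is m.+1
  then \sum_(j < N) w n j * digit_mean a w m (fun x => f (x + j%:R * a n))
  else f 0.

Section integrals.
Context (R : realType).
Local Notation B := (measurableTypeR R).
Local Notation fmeasure := {finite_measure set B -> \bar R}.

Lemma integral_delta_fset (E : {fset R}) (f : B -> \bar R) :
  measurable_fun setT f -> (forall x, 0 <= f x)%E ->
  (\int[delta_fset E]_x f x = (#|` E|%:R^-1)%:E * \sum_(e <- E) f e)%E.
Proof.
move=> mf f0.
have c0 : 0 <= (#|` E|%:R^-1 : R) by rewrite invr_ge0.
pose d (i : nat) : {measure set B -> \bar R} := \d_((enum_fset E)`_i : B).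
rewrite (eq_measure_integral (mscale (NngNum c0) (msum d #|` E|))); last first.
  move=> A mA _; rewrite /mscale /= /msum.
  transitivity ((#|` E|%:R^-1 : R)%:E * \sum_(e <- E) \d_(e : B) A)%E => //.
  by rewrite (big_nth 0) big_mkord.
rewrite ge0_integral_mscale// ge0_integral_measure_sum//.
rewrite (big_nth 0) big_mkord; congr (_ * _)%E; apply: eq_bigr => i _.
by rewrite integral_dirac// diracT mul1e.
Qed.

(** Nonnegativity lets Tonelli apply; bounded test functions are reduced to this case later by
    adding a constant. *)
Lemma integral_convolution_delta_fset (m : fmeasure) (E : {fset R}) (f : B -> \bar R) :
  measurable_fun setT f -> (forall x, 0 <= f x)%E ->
  (\int[convolution m (delta_fset E)]_x f x =
   (#|` E|%:R^-1)%:E * \sum_(e <- E) \int[m]_x f (x + e)%R)%E.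
Proof.
move=> mf f0.
have madd : measurable_fun setT (fun x : B * B => (x.1 + x.2)%R : B).
  by apply: measurable_funD; [exact: measurable_fst|exact: measurable_snd].
have mshift e : measurable_fun setT (fun x : B => (x + e)%R : B).
  by apply: measurable_funD => //; exact: measurable_cst.
rewrite ge0_integral_pushforward// preimage_setT fubini_tonelli1//=; last first.
  exact: measurableT_comp.
rewrite /fubini_F/=.
have mshiftl x : measurable_fun setT (fun y : B => (x + y)%R : B).
  by apply: measurable_funD => //; exact: measurable_cst.
under eq_integral => x _ do rewrite (integral_delta_fset E (measurableT_comp mf (mshiftl x)))//=.
rewrite ge0_integralZl//; last 2 first.
- apply: emeasurable_sum => e; exact: (measurableT_comp mf (mshift e)).
- by move=> x _; exact: sume_ge0.
congr (_ * _)%E; rewrite ge0_integral_sum// => e; exact: (measurableT_comp mf (mshift e)).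
Qed.

(** As c and t are nonzero, no two digits merge; F = 1 gives the cardinality N. *)
Lemma scaled_digits_sum (N : nat) (c : R) (t : int) (V : nmodType) (F : R -> V) :
  c != 0 -> t != 0 ->
  \sum_(e <- scale_fset c (to_reals R (digits N t))) F e =
  \sum_(j < N) F (j%:R * (c * t%:~R)).
Proof.
move=> c0 t0.
have I : injective (fun j : nat => j%:R * (c * t%:~R) : R).
  move=> i j /mulIf; rewrite mulf_neq0 ?intr_eq0// => /(_ isT)/eqP.
  by rewrite eqr_nat => /eqP.
transitivity (\sum_(e <- [seq j%:R * (c * t%:~R) | j <- iota 0 N]) F e); last first.
  by rewrite big_map -{1}[N]subn0 -/(index_iota 0 N) big_mkord.
apply: perm_big; apply: uniq_perm; rewrite ?fset_uniq ?map_inj_uniq ?iota_uniq//.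
move=> x; apply/imfsetP/mapP => /= [[_ /imfsetP[_ /= /imfsetP[j /= jN ->] ->] ->]|].
  by exists j => //; rewrite intrM; ring.
move=> [j jN ->]; exists (j%:Z * t)%:~R; last by rewrite intrM; ring.
by apply/imfsetP; exists (j%:Z * t) => //; apply/imfsetP; exists j.
Qed.

(** [finite_convolution] has n + 1 factors at index n, whence [n.+1] on the right. *)
Lemma integral_finite_convolution (N : nat) (c : nat -> R) (t : nat -> int)
    (n : nat) (f : B -> R) :
  (forall k, (1 <= k)%N -> c k != 0) -> (forall k, (1 <= k)%N -> t k != 0) ->
  measurable_fun setT f -> (forall x, 0 <= f x) ->
  (\int[finite_convolution (fun k => scale_fset (c k) (to_reals R (digits N (t k)))) n]_x
     (f x)%:E =
   (digit_mean (fun k => c k * (t k)%:~R) (fun _ (_ : 'I_N) => N%:R^-1) n.+1 f)%:E)%E.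
Proof.
move=> c0 t0 mf f0.
have cardE k : (1 <= k)%N -> #|` scale_fset (c k) (to_reals R (digits N (t k)))| = N.
  move=> k1; apply/eqP; rewrite -(eqr_nat int) -sum1_size natr_sum.
  by rewrite (scaled_digits_sum _ (fun=> 1))// ?c0 ?t0// sumr_const card_ord.
elim: n f mf f0 => [|n IH] f mf f0.
  rewrite /= integral_delta_fset//; last exact/measurable_EFinP.
  rewrite cardE// scaled_digits_sum ?c0 ?t0// sumEFin -EFinM mulr_sumr.
  by under [in RHS]eq_bigr do rewrite add0r.
rewrite [finite_convolution _ _]/= integral_convolution_delta_fset//; last first.
  exact/measurable_EFinP.
rewrite cardE// scaled_digits_sum ?c0 ?t0//.
have mshift e : measurable_fun setT (fun x : B => (x + e)%R : B).
  by apply: measurable_funD => //; exact: measurable_cst.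
under eq_bigr => j _ do
  rewrite (IH (fun x => f (x + _)) (measurableT_comp mf (mshift _)) (fun x => f0 _)).
by rewrite sumEFin -EFinM mulr_sumr.
Qed.
End integrals.

(** * Exponentials and the zeros of a geometric sum *)

Section trigonometry.
Variable R : realType.
Implicit Types (x y l : R).

Lemma cos_2piz (m : int) : cos (2 * pi * m%:~R) = 1 :> R.
Proof.
have H (n : nat) : cos (2 * pi * n%:R) = 1 :> R.
  have -> : 2 * pi * n%:R = 0 + pi *+ 2 *+ n :> R.
    by rewrite add0r; ring.
  by rewrite (periodicn (@cosD2pi R)) cos0.
case: m => n; first by rewrite -pmulrn H.
by rewrite NegzE mulrNz mulrN cosN -pmulrn H.
Qed.

Lemma cos_eq1 x : cos (2 * pi * x) = 1 -> exists m : int, x = m%:~R.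
Proof.
(* For the fractional part y of x, 1 - cos(2 pi y) = 2 sin(pi y)^2, which is positive when 0 < y <
   1. *)
move=> cx; exists (Num.floor x).
have /andP[y0 y1] : 0 <= x - (Num.floor x)%:~R < 1.
  have /andP[] := floor_itv x; rewrite intrD => *; lra.
move: y0 y1; set y := x - _ => y0 y1.
have cy : cos (2 * pi * y) = 1.
  rewrite /y mulrBr cosB cx cos_2piz; rewrite (cos1sin0 (x := 2 * pi * x)) ?cx ?normr1//.
  by rewrite mul0r addr0 mulr1.
move: y0; rewrite le_eqVlt => /predU1P[y0|y0].
  by apply/eqP; rewrite -subr_eq0 -/y -y0.
have : 0 < sin (pi * y).
  by apply: sin_gt0_pi; rewrite mulr_gt0 ?pi_gt0//= gtr_pMr ?pi_gt0.
have := cy; rewrite (_ : 2 * pi * y = (pi * y) *+ 2); last first.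
  by ring.
rewrite cos_mulr2n cos2sin2 => E s0; suff : sin (pi * y) ^+ 2 = 0.
  by move/eqP; rewrite sqrf_eq0 gt_eqF.
move: E; rewrite mulr2n; lra.
Qed.

Lemma cos_ge_1B x : 1 - `|x| <= cos x.
Proof.
rewrite -cos_norm -{1}(@cos0 R).
have [c c0x] := @MVT_segment R cos (fun x => - sin x) 0 `|x| (normr_ge0 x)
  (fun x _ => is_derive_cos x)
  (continuous_subspaceT (@continuous_cos R)).
rewrite subr0 => E; have : - sin c * `|x| >= - `|x|.
  by rewrite mulNr lerN2 ler_piMl// sin_le1.
by lra.
Qed.

Lemma cexpD l x y : cexp l (x + y) = cexp l x * cexp l y.
Proof.
by rewrite /cexp mulrDr cosD sinD; simpc; congr (_ +i* _)%C; rewrite addrC.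
Qed.

Lemma cexp0 l : cexp l 0 = 1.
Proof. by rewrite /cexp mulr0 cos0 sin0. Qed.

Lemma cexpX l x (n : nat) : cexp l (n%:R * x) = cexp l x ^+ n.
Proof.
elim: n => [|n IH]; first by rewrite mul0r cexp0.
by rewrite -natr1 mulrDl mul1r cexpD IH exprSr.
Qed.

Lemma cexp_eq1 l x : cexp l x = 1 -> exists m : int, l * x = m%:~R.
Proof. by case; rewrite -mulrA => /cos_eq1. Qed.

Lemma cexp_int l x (m : int) : l * x = m%:~R -> cexp l x = 1.
Proof.
move=> lx; have c1 : cos (2 * pi * l * x) = 1 by rewrite -mulrA lx cos_2piz.
by rewrite /cexp c1 cos1sin0 ?c1 ?normr1.
Qed.

(** A vanishing geometric sum of ratio z forces z^N = 1; z = 1 is excluded because the sum would be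
    N. *)
Lemma sum_cexp_eq0 (N : nat) l x : (0 < N)%N ->
  \sum_(j < N) cexp l (j%:R * x) = 0 ->
  exists2 m : int, N%:R * (l * x) = m%:~R & ~~ (N%:Z %| m)%Z.
Proof.
move=> N0 E; have := subrX1 (cexp l x) N.
under eq_bigr do rewrite -cexpX.
rewrite E mulr0 -cexpX => /eqP; rewrite subr_eq0 => /eqP/cexp_eq1[m lxm].
exists m; first by rewrite -lxm; ring.
apply/negP => /dvdzP[q mE].
have N1 : N%:R != 0 :> R by rewrite pnatr_eq0 -lt0n.
have lxq : l * x = q%:~R.
  apply: (mulfI N1); rewrite mulrCA lxm mE intrM mulrC; congr (_ * _).
move: E; under eq_bigr => j _ do rewrite cexpX (cexp_int lxq) expr1n.
by move/eqP; rewrite sumr_const card_ord pnatr_eq0 -leqn0 leqNgt N0.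
Qed.

End trigonometry.

(** * Fourier transforms as products of masks *)

Section digit_mean_theory.
Variables (R : realType) (N : nat) (a : nat -> R).
Implicit Types (w : nat -> 'I_N -> R) (f g : R -> R).

Lemma digit_mean_sum w n (I : Type) (r : seq I) (P : pred I)
    (c : I -> R) (f : I -> R -> R) :
  digit_mean a w n (fun x => \sum_(i <- r | P i) c i * f i x) =
  \sum_(i <- r | P i) c i * digit_mean a w n (f i).
Proof.
elim: n f => [//|n IH] f /=.
under eq_bigr do rewrite IH mulr_sumr.
rewrite exchange_big/=; apply: eq_bigr => i _.
by rewrite mulr_sumr; apply: eq_bigr => j _; rewrite mulrCA.
Qed.

Lemma digit_mean_lin2 w n c d f g :
  digit_mean a w n (fun x => c * f x + d * g x) =
  c * digit_mean a w n f + d * digit_mean a w n g.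
Proof.
have := digit_mean_sum w n [:: true; false] xpredT (fun b => if b then c else d)
  (fun b => if b then f else g).
rewrite !big_cons !big_nil !addr0 => <-; congr digit_mean.
by apply/funext => x; rewrite !big_cons big_nil addr0.
Qed.

Lemma digit_mean_le w n f g : (forall k j, 0 <= w k j) -> (forall x, f x <= g x) ->
  digit_mean a w n f <= digit_mean a w n g.
Proof.
move=> w0; elim: n f g => [|n IH] f g fg //=.
by apply: ler_sum => j _; rewrite ler_wpM2l// IH.
Qed.

(** The Fourier transform, with sign +, of the k-th factor: mass w_k(j) at j a_k. *)
Definition digit_mask w (k : nat) (l : R) : R[i] :=
  \sum_(j < N) (w k j)%:C%C * cexp l (j%:R * a k).

Definition digit_transform w (n : nat) (l : R) : R[i] :=
  (digit_mean a w n (fun x => complex.Re (cexp l x)) +i*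
   digit_mean a w n (fun x => complex.Im (cexp l x)))%C.

(** The transform of a convolution is the product of the transforms; on real and imaginary parts
    this is the addition formulas. *)
Lemma digit_transformE w n l :
  digit_transform w n l = \prod_(1 <= k < n.+1) digit_mask w k l.
Proof.
elim: n => [|n IH].
  by rewrite big_geq// /digit_transform/= mulr0 cos0 sin0.
rewrite big_nat_recr//= -IH /digit_mask mulr_sumr /digit_transform /=.
under eq_bigr => j _.
  rewrite (_ : (fun x => _) = fun x => cos (2 * pi * l * (j%:R * a n.+1)) * cos (2 * pi * l * x)
     + (- sin (2 * pi * l * (j%:R * a n.+1))) * sin (2 * pi * l * x)); last first.
    by apply/funext => x; rewrite mulrDr cosD; ring.
  rewrite digit_mean_lin2; over.
under [X in (_ +i* X)%C]eq_bigr => j _.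
  rewrite (_ : (fun x => _) = fun x => sin (2 * pi * l * (j%:R * a n.+1)) * cos (2 * pi * l * x)
     + cos (2 * pi * l * (j%:R * a n.+1)) * sin (2 * pi * l * x)); last first.
    by apply/funext => x; rewrite mulrDr sinD; ring.
  rewrite digit_mean_lin2; over.
apply/eqP; rewrite eq_complex /= !raddf_sum/=; apply/andP; split; apply/eqP/eq_bigr => j _.
  by ring.
by ring.
Qed.

End digit_mean_theory.

(** * Lower bound for infinite products of masks *)

Section nonvanishing.
Variable R : realType.

Lemma half_pow_small (D e : R) : 0 < e -> exists m : nat, D / 2 ^+ m < e.
Proof.
move=> e0; exists (Num.bound (D / e)).
rewrite ltr_pdivrMr ?exprn_gt0// mulrC -ltr_pdivrMr//.
have [D0|D0] := leP 0 (D / e); last by apply: (lt_le_trans D0); rewrite exprn_ge0.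
apply: (lt_trans (archi_boundP D0)); rewrite -natrX ltr_nat; exact: ltn_expl.
Qed.

Lemma sqnormE (z : R[i]) : (sqnorm z)%:C%C = z * z^*%C.
Proof.
case: z => x y; rewrite /sqnorm /=; apply/eqP; rewrite eq_complex /=.
by apply/andP; split; apply/eqP; ring.
Qed.

Lemma sqnormM (z t : R[i]) : sqnorm (z * t) = sqnorm z * sqnorm t.
Proof. by case: z t => [x y] [u v]; rewrite /sqnorm /=; ring. Qed.

Lemma sqnorm_ge0 (z : R[i]) : 0 <= sqnorm z.
Proof. by rewrite /sqnorm addr_ge0 ?sqr_ge0. Qed.

Lemma sqnorm_eq0 (z : R[i]) : (sqnorm z == 0) = (z == 0).
Proof. by rewrite /sqnorm paddr_eq0 ?sqr_ge0// !sqrf_eq0 eq_complex. Qed.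

Lemma sqnorm_prod (I : Type) (r : seq I) (F : I -> R[i]) :
  sqnorm (\prod_(i <- r) F i) = \prod_(i <- r) sqnorm (F i).
Proof.
apply: (big_morph _ sqnormM).
by rewrite /sqnorm /= expr1n expr0n addr0.
Qed.

Variables (N : nat) (a : nat -> R) (K : R).
Hypothesis N_gt0 : (0 < N)%N.
Hypothesis aK : forall k, (1 <= k)%N -> `|a k| <= K / 2 ^+ k.

Let w (k : nat) (j : 'I_N) : R := N%:R^-1.

Let N0 : N%:R != 0 :> R. Proof. by rewrite pnatr_eq0 -lt0n. Qed.

Lemma sum_uniform_weights k : \sum_j w k j = 1.
Proof. by rewrite sumr_const card_ord -[_ *+ _]mulr_natr mulVf. Qed.

(** The mask averages cosines of angles of size at most 2 pi |l| N K / 2^k, and cos y >= 1 - |y|. *)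
Lemma uniform_mask_ge (l : R) k : (1 <= k)%N ->
  1 - 2 * pi * `|l| * N%:R * K / 2 ^+ k <= complex.Re (digit_mask a w k l).
Proof.
move=> k1; set u := 1 - _; rewrite -[u]mul1r -(sum_uniform_weights k) mulr_suml {}/u.
rewrite /digit_mask raddf_sum/=.
apply: ler_sum => j _; rewrite mul0r subr0.
apply: ler_wpM2l; first by rewrite invr_ge0.
apply: le_trans (cos_ge_1B _); rewrite lerD2l lerN2 -!mulrA 2!normrM.
rewrite (gtr0_norm (ltr0n _ 2)) (gtr0_norm (pi_gt0 R)) 2!normrM normr_nat.
rewrite !ler_wpM2l ?pi_ge0//; apply: ler_pM => //; last exact: aK.
by rewrite ler_nat ltnW.
Qed.

(* The infinite product of the masks converges, so it vanishes only when a
   factor does. *)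
Lemma uniform_transform_ge (l : R) :
  (forall k, (1 <= k)%N -> digit_mask a w k l != 0) ->
  exists m, exists2 d : R, 0 < d &
    forall n, (m <= n)%N -> d <= sqnorm (digit_transform a w n l).
Proof.
move=> nz; pose C := 2 * (2 * pi * `|l| * N%:R * K).
have K0 : 0 <= K.
  by have := aK (leqnn 1); have := normr_ge0 (a 1%N); rewrite expr1; lra.
have C0 : 0 <= C by rewrite !mulr_ge0 ?pi_ge0.
(* C doubles the constant of the mask bound because (1 - u)^2 >= 1 - 2u; m makes the total loss
   beyond m at most 1/2. *)
have [m Cm] := half_pow_small C (ltac:(lra) : 0 < 2^-1 :> R).
pose d := \prod_(1 <= k < m.+1) sqnorm (digit_mask a w k l).
have d0 : 0 < d.
  rewrite /d big_seq_cond; apply: prodr_gt0 => k; rewrite andbT mem_index_iota.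
  by move=> /andP[k1 _]; rewrite lt_def sqnorm_eq0 sqnorm_ge0 nz.
exists m; exists (d / 2) => [|n mn]; first by rewrite divr_gt0.
rewrite digit_transformE sqnorm_prod (big_cat_nat (n := m.+1))//= -/d.
rewrite ler_wpM2l ?(ltW d0)//.
(* A product of factors 1 - u_k is at least 1 minus the sum of the u_k; here u_k = C / 2^k, summed
   geometrically over m < k <= n. *)
suff : 1 - C * ((2 ^+ m)^-1 - (2 ^+ n)^-1) <=
    \prod_(m.+1 <= k < n.+1) sqnorm (digit_mask a w k l).
  apply: le_trans; have : 0 <= C / 2 ^+ n by rewrite divr_ge0 ?exprn_ge0.
  by move: Cm; rewrite mulrBr; lra.
elim: n mn => [|n IH].
  by rewrite leqn0 => /eqP ->; rewrite big_geq// subrr mulr0 subr0.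
rewrite leq_eqVlt => /predU1P[<-|].
  by rewrite big_geq// subrr mulr0 subr0.
rewrite ltnS => mn; rewrite big_nat_recr//=.
have E : 2 * (2 ^+ n.+1)^-1 = (2 ^+ n)^-1 :> R.
  by rewrite exprS invfM mulrA divff ?mul1r.
have mn' : C / 2 ^+ n.+1 <= 2^-1.
  apply: le_trans (ltW Cm); rewrite ler_wpM2l// lef_pV2 ?posrE ?exprn_gt0//.
  by rewrite ler_eXn2l ?ltr1n// leqW.
have /IH {}IH := mn; set P := \prod_(_ <= _ < _) _ in IH *.
have u0 : 0 <= C / 2 ^+ n.+1 by rewrite divr_ge0 ?exprn_ge0.
have S1 : 1 - C / 2 ^+ n.+1 <= sqnorm (digit_mask a w n.+1 l).
  have := uniform_mask_ge l (isT : 1 <= n.+1)%N.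
  move: u0 mn'.
  have -> : C / 2 ^+ n.+1 = 2 * (2 * pi * `|l| * N%:R * K / 2 ^+ n.+1).
    by rewrite /C; ring.
  move: (_ / 2 ^+ n.+1) => u u0 u1; rewrite /sqnorm.
  by move: (complex.Re _) (complex.Im _) => x y; nra.
have s0 : 0 <= C * ((2 ^+ m)^-1 - (2 ^+ n)^-1).
  rewrite mulr_ge0// subr_ge0 lef_pV2 ?posrE ?exprn_gt0//.
  by rewrite ler_eXn2l ?ltr1n.
have P0 : 0 <= P by apply: prodr_ge0 => k _; exact: sqnorm_ge0.
have {E}E : C * (2 ^+ n)^-1 = 2 * (C / 2 ^+ n.+1) by rewrite -E; ring.
move: IH s0 u0 mn' S1; rewrite !mulrBr E.
move: (C / 2 ^+ m) (C / 2 ^+ n.+1) (sqnorm _) => x y z; nra.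
Qed.

End nonvanishing.

(** * Testing against a bump at the top of the support *)

Section trigonometric_polynomials.
Variables (R : realType) (N : nat) (a : nat -> R).
Implicit Types (w : nat -> 'I_N -> R).

Lemma digit_mean_Re_cexp w n (z : R[i]) (l : R) :
  digit_mean a w n (fun x => complex.Re (z * cexp l x)) =
  complex.Re (z * digit_transform a w n l).
Proof.
case: z => u v; rewrite /= -mulNr -digit_mean_lin2; congr digit_mean.
by apply/funext => x; rewrite mulNr.
Qed.

Lemma cexpB (l l' x : R) : cexp (l - l') x = cexp l x * (cexp l' x)^*%C.
Proof.
rewrite /cexp mulrBr mulrBl cosB sinB; apply/eqP; rewrite eq_complex /=.
by apply/andP; split; apply/eqP; ring.
Qed.

Lemma digit_mean_sqnorm w n (I : finType) (S : pred I) (c : I -> R[i]) (l : I -> R) :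
  digit_mean a w n (fun x => sqnorm (\sum_(i | S i) c i * cexp (l i) x)) =
  \sum_(i | S i) \sum_(i' | S i')
    complex.Re (c i * (c i')^*%C * digit_transform a w n (l i - l i')).
Proof.
pose f i i' x := complex.Re (c i * (c i')^*%C * cexp (l i - l i') x).
transitivity (digit_mean a w n
    (fun x => \sum_(i | S i) 1 * \sum_(i' | S i') 1 * f i i' x)).
  congr digit_mean; apply/funext => x.
  rewrite (_ : sqnorm _ = complex.Re (sqnorm (\sum_(i | S i) c i * cexp (l i) x))%:C%C)//.
  rewrite sqnormE rmorph_sum mulr_suml raddf_sum/=; apply: eq_bigr => i _.
  rewrite mul1r mulr_sumr raddf_sum/=; apply: eq_bigr => i' _.
  by rewrite mul1r /f cexpB rmorphM/=; congr complex.Re; ring.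
rewrite digit_mean_sum; apply: eq_bigr => i _.
rewrite mul1r digit_mean_sum; apply: eq_bigr => i' _.
by rewrite mul1r digit_mean_Re_cexp.
Qed.

(** Frequencies may repeat in the family l, so the surviving terms are the pairs of equal frequency,
    not just the diagonal. *)
Lemma digit_mean_sqnorm_orthogonal w n (t : R) (I : finType) (S : pred I)
    (c : I -> R[i]) (l : I -> R) :
  digit_transform a w n 0 = t%:C%C ->
  (forall i i', S i -> S i' -> l i != l i' -> digit_transform a w n (l i - l i') = 0) ->
  digit_mean a w n (fun x => sqnorm (\sum_(i | S i) c i * cexp (l i) x)) =
  t * \sum_(i | S i) \sum_(i' | S i' && (l i == l i')) complex.Re (c i * (c i')^*%C).
Proof.
move=> T0 orth; rewrite digit_mean_sqnorm mulr_sumr; apply: eq_bigr => i Si.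
rewrite mulr_sumr big_mkcondr/=; apply: eq_bigr => i' Si'.
case: eqVneq => [->|ll]; last by rewrite orth// mulr0.
by rewrite subrr T0; case: (c i * _) => u v /=; ring.
Qed.

(** Cauchy-Schwarz, read off from the nonnegative sum of the (n x_i - s)^2. *)
Lemma sqr_sum_le (n : nat) (x : 'I_n -> R) :
  (\sum_i x i) ^+ 2 <= n%:R * \sum_i x i ^+ 2.
Proof.
case: n x => [|n] x; first by rewrite !big_ord0 expr0n mulr0.
set s := \sum_i x i; set q := \sum_i x i ^+ 2.
have : 0 <= \sum_i (n.+1%:R * x i - s) ^+ 2 by apply: sumr_ge0 => i _; exact: sqr_ge0.
have -> : \sum_i (n.+1%:R * x i - s) ^+ 2 = n.+1%:R * (n.+1%:R * q - s ^+ 2).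
  transitivity (\sum_i
      (n.+1%:R ^+ 2 * x i ^+ 2 + (- (2 * n.+1%:R * s)) * x i + s ^+ 2)).
    by apply: eq_bigr => i _; ring.
  rewrite !big_split/= -!mulr_sumr sumr_const card_ord -/s -/q -mulr_natr; ring.
by rewrite pmulr_rge0 ?ltr0n// subr_ge0.
Qed.

Lemma sqnorm_sum_le (n : nat) (z : 'I_n -> R[i]) :
  sqnorm (\sum_i z i) <= n%:R * \sum_i sqnorm (z i).
Proof.
rewrite /sqnorm !raddf_sum/= big_split/= mulrDr.
by apply: lerD; exact: sqr_sum_le.
Qed.

(* The colour classes are orthogonal for both weights; splitting P along them
   and Cauchy-Schwarz cost only one factor N. *)
Lemma colouring_bound (w w' : nat -> 'I_N -> R) n (I : finType) (c : I -> R[i])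
    (l : I -> R) (chi : R -> 'I_N) :
  (forall k j, 0 <= w' k j) ->
  digit_transform a w n 0 = 1 ->
  digit_transform a w' n 0 = (N%:R ^- 2)%:C%C ->
  (forall i i', l i != l i' -> digit_transform a w n (l i - l i') = 0) ->
  (forall i i', l i != l i' -> chi (l i) = chi (l i') ->
     digit_transform a w' n (l i - l i') = 0) ->
  N%:R * digit_mean a w' n (fun x => sqnorm (\sum_i c i * cexp (l i) x)) <=
  digit_mean a w n (fun x => sqnorm (\sum_i c i * cexp (l i) x)).
Proof.
move=> w'0 T1 T1' orth orth'.
have Npos : (0 < N)%N by apply: leq_ltn_trans (ltn_ord (chi 0)).
have N0 : N%:R != 0 :> R by rewrite pnatr_eq0 -lt0n.
pose P (j : 'I_N) x := \sum_(i | chi (l i) == j) c i * cexp (l i) x.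
have PE x : \sum_i c i * cexp (l i) x = \sum_j P j x.
  by rewrite (partition_big (fun i => chi (l i)) xpredT)//=.
apply: (@le_trans _ _ (N%:R * digit_mean a w' n
    (fun x => \sum_(j < N) N%:R * sqnorm (P j x)))).
  apply: ler_wpM2l => //; apply: digit_mean_le => // x.
  by rewrite PE -mulr_sumr; exact: sqnorm_sum_le.
rewrite digit_mean_sum.
have PjE j : digit_mean a w' n (fun x => sqnorm (P j x)) = N%:R ^- 2 *
    \sum_(i | chi (l i) == j) \sum_(i' | l i == l i') complex.Re (c i * (c i')^*%C).
  rewrite (digit_mean_sqnorm_orthogonal c T1'); last first.
    by move=> i i' /eqP ci /eqP ci' ll; apply: orth' => //; rewrite ci.
  congr (_ * _); apply: eq_bigr => i /eqP ci; apply: eq_bigl => i'.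
  (* The colour depends on the frequency alone, so equal frequencies share a class. *)
  by case: (eqVneq (l i)) => [<-|_]; rewrite ?andbF// ci eqxx.
rewrite (@digit_mean_sqnorm_orthogonal w n 1 I xpredT c l) ?T1//; last first.
  by move=> *; exact: orth.
rewrite mul1r (partition_big (fun i => chi (l i)) xpredT)//= mulr_sumr.
(* Equality in each class: N from the statement, N from Cauchy-Schwarz, N^-2 from the mass of w'. *)
apply: ler_sum => j _; rewrite PjE; by rewrite le_eqVlt; apply/orP; left; apply/eqP; field.
Qed.
End trigonometric_polynomials.

(** * The top corner of the support *)

Section top_corner.
Variables (R : realType) (n' : nat) (a : nat -> R) (K : R).
Local Notation N := n'.+2.
Hypothesis aK : forall k, (1 <= k)%N -> `|a k| <= K / 2 ^+ k.

Definition top_digit (k : nat) : 'I_N := if 0 <= a k then ord_max else ord0.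

Lemma top_digitP k (j : 'I_N) : j%:R * a k <= (top_digit k)%:R * a k.
Proof.
rewrite /top_digit; case: (leP 0 (a k)) => /= [a0|/ltW a0].
  by rewrite ler_wpM2r// ler_nat -ltnS.
by rewrite mul0r mulr_ge0_le0.
Qed.

Lemma top_digit_gap k (j : 'I_N) : j != top_digit k ->
  j%:R * a k <= (top_digit k)%:R * a k - `|a k|.
Proof.
rewrite /top_digit; case: (leP 0 (a k)) => /= [a0|a0] jk.
  rewrite ger0_norm// lerBrDr -[X in _ + X]mul1r -mulrDl ler_wpM2r//.
  by rewrite natr1 ler_nat ltn_neqAle jk -ltnS /=.
rewrite mul0r sub0r ltr0_norm// opprK -[leRHS]mul1r ler_wnM2r ?(ltW a0)//.
by rewrite ler1n lt0n; apply: contra jk => /eqP j0; apply/eqP/val_inj.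
Qed.

Definition top (n : nat) : R := \sum_(1 <= k < n.+1) (top_digit k)%:R * a k.

Lemma topS n : top n.+1 = top n + (top_digit n.+1)%:R * a n.+1.
Proof. by rewrite /top big_nat_recr. Qed.

Lemma digit_mean_above_top (w : nat -> 'I_N -> R) n (f : R -> R) :
  (forall x, x <= top n -> f x = 0) -> digit_mean a w n f = 0.
Proof.
elim: n f => [|n IH] f f0 /=; first by apply: f0; rewrite /top big_geq.
rewrite big1// => j _; rewrite IH ?mulr0// => x xn.
by apply: f0; rewrite topS lerD// top_digitP.
Qed.

Variables (p q : nat).
Hypotheses (p1 : (1 <= p)%N) (q1 : (1 <= q)%N) (pq : p != q).

Let unif (k : nat) (j : 'I_N) : R := N%:R^-1.

(* The weights of the event that the digits p and q are the top ones. *)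
Let corner (k : nat) (j : 'I_N) : R :=
  if ((k == p) || (k == q)) && (j != top_digit k) then 0 else N%:R^-1.

(** A digit p or q that is not the top one lowers the sum by at least e, into the region where f
    vanishes. *)
Lemma digit_mean_near_top n (f : R -> R) (e : R) :
  e <= `|a p| -> e <= `|a q| -> (forall x, x <= top n - e -> f x = 0) ->
  digit_mean a unif n f = digit_mean a corner n f.
Proof.
move=> ep eq; elim: n f => [//|n IH] f f0 /=; apply: eq_bigr => j _.
rewrite (IH (fun x => f (x + j%:R * a n.+1))) => [|x xn]; last first.
  by apply: f0; rewrite topS; have := top_digitP n.+1 j; lra.
rewrite /unif /corner; case: ifPn => // /andP[npq jt].
rewrite digit_mean_above_top ?mulr0// => x xn; apply: f0; rewrite topS.
have := top_digit_gap jt.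
by case/orP: npq => /eqP E; rewrite -E in ep eq *; lra.
Qed.

Lemma corner_mask k (l : R) : k != p -> k != q ->
  digit_mask a corner k l = digit_mask a unif k l.
Proof.
by move=> /negPf kp /negPf kq; apply: eq_bigr => j _; rewrite /corner kp kq.
Qed.

(** At frequency 0 each mask is the total mass of its factor: 1/N at p and at q, and 1 elsewhere. *)
Lemma corner_transform0 n : (p <= n)%N -> (q <= n)%N ->
  digit_transform a corner n 0 = (N%:R ^- 2)%:C%C.
Proof.
move=> pn qn; rewrite digit_transformE.
have mE k : digit_mask a corner k 0 =
    (if k == p then N%:R^-1 else 1)%:C%C * (if k == q then N%:R^-1 else 1)%:C%C.
  transitivity ((\sum_(j < N) corner k j)%:C%C : R[i]).
    rewrite rmorph_sum; apply: eq_bigr => j _.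
    by rewrite /cexp !(mulr0, mul0r) cos0 sin0 mulr1.
  rewrite -rmorphM; congr (_%:C)%C; have [/orP kpq|] := boolP ((k == p) || (k == q)).
    rewrite (bigD1 (top_digit k))//= /corner eqxx andbF big1 => [|j jt]; last first.
      by rewrite jt andbT; case/orP: kpq => ->; rewrite ?orbT.
    rewrite addr0; case: kpq => /eqP ->; rewrite eqxx.
      by rewrite (negPf pq) mulr1.
    by rewrite eq_sym (negPf pq) mul1r.
  move=> /[dup] + /norP[/negPf -> /negPf ->]; rewrite mulr1 => kpq.
  rewrite -(sum_uniform_weights R (ltn0Sn n'.+1) k).
  by apply: eq_bigr => j _; rewrite /corner (negPf kpq).
under eq_bigr do rewrite mE.
rewrite big_split/= -!rmorph_prod -rmorphM; congr (_%:C)%C.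
have H r : (1 <= r)%N -> (r <= n)%N ->
    \prod_(1 <= k < n.+1) (if k == r then N%:R^-1 else 1) = N%:R^-1 :> R.
  by move=> r1 rn; rewrite -big_mkcond big_nat1_eq ltnS r1 rn.
by rewrite !H// -invfM -expr2.
Qed.

Lemma unif_transform0 n : digit_transform a unif n 0 = 1.
Proof.
rewrite digit_transformE big1// => k _.
transitivity ((\sum_(j < N) unif k j)%:C%C : R[i]); last first.
  by rewrite sum_uniform_weights.
rewrite rmorph_sum; apply: eq_bigr => j _.
by rewrite /cexp !(mulr0, mul0r) cos0 sin0 mulr1.
Qed.

(** A bound on the total displacement by the digits after n; its decrement bounds a single step. *)
Let tail (n : nat) := N%:R * K / 2 ^+ n.

Let step_le_tail n (j : 'I_N) : `|j%:R * a n.+1| <= tail n - tail n.+1.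
Proof.
have -> : tail n - tail n.+1 = N%:R * (K / 2 ^+ n.+1).
  rewrite /tail exprS invfM; field.
  by rewrite expf_neq0.
rewrite normrM normr_nat; apply: ler_pM => //; last exact: aK.
by rewrite ler_nat ltnW.
Qed.

Lemma top_tail n0 n : (n0 <= n)%N -> top n <= top n0 + tail n0 - tail n.
Proof.
elim: n => [|n IH]; first by rewrite leqn0 => /eqP ->; lra.
rewrite leq_eqVlt => /predU1P[->|]; first lra.
rewrite ltnS => /IH; rewrite topS; have := step_le_tail n (top_digit n.+1).
by rewrite ler_norml => /andP[]; lra.
Qed.

Lemma digit_mean_top_ge n0 n (f : R -> R) (d : R) : (n0 <= n)%N ->
  (forall x, 0 <= f x) -> (forall x, top n0 - (tail n0 - tail n) <= x -> d <= f x) ->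
  N%:R ^- n0 * d <= digit_mean a unif n f.
Proof.
have Nge0 : 0 <= N%:R^-1 :> R by rewrite invr_ge0.
elim: n f => [|n IH] f.
  rewrite leqn0 => /eqP -> f0 fd /=; rewrite expr0 invr1 mul1r; apply: fd.
  by rewrite /top big_geq//; lra.
have nn m (g : R -> R) : (forall x, 0 <= g x) -> 0 <= digit_mean a unif m g.
  move=> g0; elim: m g g0 => [|m IHm] g g0 //=.
  by apply: sumr_ge0 => j _; rewrite mulr_ge0// IHm.
rewrite leq_eqVlt => /predU1P[n0E|].
  move=> f0 fd; rewrite n0E in fd *; clear IH n0E n0.
  elim: n.+1 f f0 fd => {n} [|n IH] f f0 fd.
    by rewrite /= expr0 invr1 mul1r; apply: fd; rewrite /top big_geq//; lra.
  (* Up to n0 only the top digit is kept at each step, at the cost of a factor 1/N. *)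
  rewrite /= (bigD1 (top_digit n.+1))//= -[leLHS]addr0; apply: lerD; last first.
    by apply: sumr_ge0 => j _; rewrite mulr_ge0// nn.
  rewrite exprS invfM -mulrA; apply: ler_wpM2l => //; apply: IH => // x xn.
  by apply: fd; rewrite topS; lra.
rewrite ltnS => n0n f0 fd /=.
(* Beyond n0 every digit is kept: the weights sum to 1 and the displacement is charged to [tail]. *)
rewrite (_ : _ * d = \sum_j unif 0 j * (N%:R ^- n0 * d)); last first.
  by rewrite -mulr_suml sum_uniform_weights// mul1r.
apply: ler_sum => j _; apply: ler_wpM2l => //; apply: IH => // x xn; apply: fd.
have := step_le_tail n j; rewrite ler_norml => /andP[]; lra.
Qed.

(* Since g vanishes below the top corner, only the corner weights see g, and
   under these P has at most 1/N of its mass: hence no P approximates g. *)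
Lemma top_bump_not_approximable : a p != 0 -> a q != 0 ->
  exists2 g : R -> R, continuous g /\ (forall x, 0 <= g x <= 1) &
  exists2 e : R, 0 < e & exists n0, forall n, (n0 <= n)%N ->
  forall (I : finType) (c : I -> R[i]) (l : I -> R) (chi : R -> 'I_N),
  (forall i i', l i != l i' -> digit_transform a unif n (l i - l i') = 0) ->
  (forall i i', l i != l i' -> chi (l i) = chi (l i') ->
     digit_transform a corner n (l i - l i') = 0) ->
  e <= digit_mean a unif n (fun x => sqnorm ((g x)%:C%C - \sum_i c i * cexp (l i) x)).
Proof.
move=> ap aq; pose e := Num.min `|a p| `|a q|.
have e0 : 0 < e by rewrite lt_min !normr_gt0 ap aq.
have [m tm] := half_pow_small (N%:R * K) (ltac:(lra) : 0 < e / 3).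
rewrite -/(tail m) in tm.
have tail0 n : 0 <= tail n.
  rewrite /tail divr_ge0 ?exprn_ge0// mulr_ge0//.
  by have := aK (leqnn 1); have := normr_ge0 (a 1%N); rewrite expr1; lra.
(* For n >= m, [top n] is at most [top m + tail m], so [th] is at least [top n - e]; since
   [tail m < e / 3], points above [top m - tail m] still exceed [th] by e/3. *)
pose th := top m + tail m - e.
pose g (x : R) := Num.min 1 (Num.max 0 (x - th)).
have g0 x : 0 <= g x by rewrite le_min ler01 le_max lexx.
have g1 x : g x <= 1 by rewrite ge_min lexx.
exists g.
  split=> [x|x]; last by rewrite g0 g1.
  apply: (@continuous_min _ _ (fun=> 1 : R^o) (fun x => Num.max 0 (x - th) : R^o)).
    exact: cst_continuous.
  apply: (@continuous_max _ _ (fun=> 0 : R^o) (fun x => x - th : R^o)).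
    exact: cst_continuous.
  by apply: continuousB => //; exact: cst_continuous.
pose d := (Num.min 1 (e / 3)) ^+ 2.
have d0 : 0 < d by rewrite exprn_gt0// lt_min ltr01 divr_gt0.
have N1 : (N%:R^-1 : R) < 1 by rewrite invf_lt1 ?ltr0n// ltr1n.
exists ((1 - N%:R^-1) * (N%:R ^- m * d)).
  apply: mulr_gt0; first by rewrite subr_gt0.
  by apply: mulr_gt0 => //; rewrite invr_gt0 exprn_gt0.
exists (maxn m (maxn p q)) => n; rewrite !geq_max => /and3P[mn pn qn] I c l chi orth orth'.
set P := fun x => \sum_i c i * cexp (l i) x.
have PN : N%:R * digit_mean a corner n (fun x => sqnorm (P x)) <=
    digit_mean a unif n (fun x => sqnorm (P x)).
  apply: colouring_bound orth orth'; rewrite ?unif_transform0 ?corner_transform0//.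
  by move=> k j; rewrite /corner; case: ifP.
(* |g - P|^2 splits into h, which vanishes with g and is thus seen only at the corner, and |P|^2,
   which keeps its full mean. *)
pose h x := g x ^+ 2 - 2 * g x * complex.Re (P x).
have hE x : sqnorm ((g x)%:C%C - P x) = 1 * h x + 1 * sqnorm (P x).
  by rewrite /h /sqnorm; case: (P x) => u v /=; ring.
rewrite (_ : (fun x => _) = fun x => 1 * h x + 1 * sqnorm (P x)); last first.
  by apply/funext => x; rewrite hE.
have near (f : R -> R) : (forall y, y <= th -> f y = 0) ->
    digit_mean a unif n f = digit_mean a corner n f.
  move=> f0; apply: (@digit_mean_near_top _ _ e); rewrite ?ge_min ?lexx ?orbT// => y yn.
  by apply: f0; have := top_tail mn; have := tail0 n; rewrite /th; lra.
have gth y : y <= th -> g y = 0.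
  by move=> yth; rewrite /g (_ : Num.max _ _ = 0) ?(min_idPr _)//; apply/max_idPl; lra.
rewrite digit_mean_lin2 !mul1r (near h) => [|y yth]; last first.
  by rewrite /h gth//; ring.
(* Completing the square gives (1 - 1/N) g^2 - N |P|^2 <= h pointwise; [PN] pays for the term N
   |P|^2. *)
have : digit_mean a corner n (fun x => (1 - N%:R^-1) * g x ^+ 2 + (- N%:R) * sqnorm (P x))
    <= digit_mean a corner n h.
  apply: digit_mean_le => [k j|x]; first by rewrite /corner; case: ifP.
  have : 0 <= N%:R^-1 * (g x - N%:R * complex.Re (P x)) ^+ 2 + N%:R * complex.Im (P x) ^+ 2.
    by rewrite addr_ge0// mulr_ge0// sqr_ge0.
  rewrite /h /sqnorm; move: (complex.Re _) (complex.Im _) => u v.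
  have -> : N%:R^-1 * (g x - N%:R * u) ^+ 2 =
      N%:R^-1 * g x ^+ 2 - 2 * g x * u + N%:R * u ^+ 2 by field.
  by move: (N%:R^-1 : R) (N%:R : R) => y z; lra.
rewrite digit_mean_lin2 -(near (fun x => g x ^+ 2)) => [|y yth]; last first.
  by rewrite gth// expr0n.
have : N%:R ^- m * d <= digit_mean a unif n (fun x => g x ^+ 2).
  apply: digit_mean_top_ge mn _ _ => x; first exact: sqr_ge0.
  move=> xm; rewrite /d ler_pXn2r ?nnegrE ?g0//; last by rewrite le_min ler01 divr_ge0// ltW.
  rewrite /g le_min ge_min lexx/= le_max; apply/orP; right.
  rewrite ge_min; apply/orP; right.
  by have := tail0 n; rewrite /th in xm *; lra.
move=> H1 H2.
have : (1 - N%:R^-1) * (N%:R ^- m * d) <=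
    (1 - N%:R^-1) * digit_mean a unif n (fun x => g x ^+ 2).
  by apply: ler_wpM2l => //; rewrite subr_ge0 ltW.
move=> H3; apply: (le_trans H3); apply: le_trans (lerD H2 PN).
by rewrite mulNr subrK.
Qed.
End top_corner.

(** * Passage to the infinite convolution *)

Section bounded_continuous.
Variable R : realType.
Implicit Types f g : R -> R.

Definition bounded_continuous f := continuous f /\ exists M, forall x, `|f x| <= M.

Lemma bounded_continuous_cst (r : R) : bounded_continuous (fun=> r).
Proof. by split; [move=> x; exact: cst_continuous|exists `|r|]. Qed.

Lemma bounded_continuousD f g : bounded_continuous f -> bounded_continuous g ->
  bounded_continuous (fun x => f x + g x).
Proof.
move=> [cf [M fM]] [cg [P gP]]; split.
  by move=> x; apply: continuousD; [exact: cf|exact: cg].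
by exists (M + P) => x; rewrite (le_trans (ler_normD _ _))// lerD.
Qed.

Lemma bounded_continuousM f g : bounded_continuous f -> bounded_continuous g ->
  bounded_continuous (fun x => f x * g x).
Proof.
move=> [cf [M fM]] [cg [P gP]]; split.
  by move=> x; apply: continuousM; [exact: cf|exact: cg].
by exists (M * P) => x; rewrite normrM ler_pM.
Qed.

Lemma bounded_continuousN f : bounded_continuous f -> bounded_continuous (fun x => - f x).
Proof.
move=> [cf [M fM]]; split; first by move=> x; apply: continuousN; exact: cf.
by exists M => x; rewrite normrN.
Qed.

Lemma bounded_continuous_sum (I : Type) (r : seq I) (f : I -> R -> R) :
  (forall i, bounded_continuous (f i)) ->
  bounded_continuous (fun x => \sum_(i <- r) f i x).
Proof.
move=> fB; elim: r => [|i r IH].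
  rewrite (_ : (fun _ => _) = fun=> 0); first exact: bounded_continuous_cst.
  by apply/funext => x; rewrite big_nil.
rewrite (_ : (fun _ => _) = fun x => f i x + \sum_(k <- r) f k x).
  exact: bounded_continuousD.
by apply/funext => x; rewrite big_cons.
Qed.

Lemma bounded_continuous_Re_cexp l : bounded_continuous (fun x : R => complex.Re (cexp l x)).
Proof.
split=> [x|]; last by exists 1 => x; exact: cos_max.
apply: (@continuous_comp _ _ _ (fun x => 2 * pi * l * x) cos); last exact: continuous_cos.
by apply: continuousM => //; exact: cst_continuous.
Qed.

Lemma bounded_continuous_Im_cexp l : bounded_continuous (fun x : R => complex.Im (cexp l x)).
Proof.
split=> [x|]; last by exists 1 => x; exact: sin_max.
apply: (@continuous_comp _ _ _ (fun x => 2 * pi * l * x) sin); last exact: continuous_sin.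
by apply: continuousM => //; exact: cst_continuous.
Qed.

Lemma bounded_continuous_sqnorm (F : R -> R[i]) :
  bounded_continuous (fun x => complex.Re (F x)) ->
  bounded_continuous (fun x => complex.Im (F x)) ->
  bounded_continuous (fun x => sqnorm (F x)).
Proof.
by move=> FR FI; apply: bounded_continuousD; apply: bounded_continuousM.
Qed.

Lemma bounded_continuous_trig (n : nat) (c : 'I_n -> R[i]) (l : 'I_n -> R) :
  bounded_continuous (fun x => complex.Re (\sum_i c i * cexp (l i) x)) /\
  bounded_continuous (fun x => complex.Im (\sum_i c i * cexp (l i) x)).
Proof.
split.
  rewrite (_ : (fun _ => _) = fun x => \sum_i complex.Re (c i * cexp (l i) x)).
    apply: bounded_continuous_sum => i; case: (c i) => u v /=.
    apply: bounded_continuousD; last apply: bounded_continuousN;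
      apply: bounded_continuousM; try exact: bounded_continuous_cst.
      exact: bounded_continuous_Re_cexp.
    exact: bounded_continuous_Im_cexp.
  by apply/funext => x; rewrite raddf_sum.
rewrite (_ : (fun _ => _) = fun x => \sum_i complex.Im (c i * cexp (l i) x)).
  apply: bounded_continuous_sum => i; case: (c i) => u v /=.
  apply: bounded_continuousD;
    apply: bounded_continuousM; try exact: bounded_continuous_cst.
    exact: bounded_continuous_Im_cexp.
  exact: bounded_continuous_Re_cexp.
by apply/funext => x; rewrite raddf_sum.
Qed.

Lemma bounded_continuous_measurable f : bounded_continuous f ->
  measurable_fun [set: measurableTypeR R] (f : measurableTypeR R -> R).
Proof. by case=> cf _; exact: continuous_measurable_fun. Qed.

Lemma bounded_continuous_integrable (m : {finite_measure set (measurableTypeR R) -> \bar R}) f :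
  bounded_continuous f -> m.-integrable setT (EFin \o f).
Proof.
move=> fB; apply: measurable_bounded_integrable => //.
- by rewrite ltey_eq fin_num_measure.
- exact: bounded_continuous_measurable.
- case: fB => _ [M fM]; exists M; split; first exact: num_real.
  by move=> x Mx y _; apply: le_trans (ltW Mx).
Qed.

End bounded_continuous.

(** * Orthogonality and density in the weak limit *)

Section spectrum.
Local Open Scope classical_set_scope.
Local Open Scope ring_scope.
Variables (R : realType) (n' : nat) (c : nat -> R) (t : nat -> int) (K : R).
Local Notation N := n'.+2.
Hypothesis c0 : forall k, (1 <= k)%N -> c k != 0.
Hypothesis t0 : forall k, (1 <= k)%N -> t k != 0.
Let a k := c k * (t k)%:~R.
Hypothesis aK : forall k, (1 <= k)%N -> `|a k| <= K / 2 ^+ k.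
Variable mu : probability (measurableTypeR R) R.
Hypothesis mu_conv : is_infinite_convolution
  (fun k => scale_fset (c k) (to_reals R (digits N (t k)))) mu.

Let unif (k : nat) (j : 'I_N) : R := N%:R^-1.

Lemma digit_mean_cst n (r : R) : digit_mean a unif n (fun=> r) = r.
Proof.
elim: n => [//|n IH] /=.
under eq_bigr do rewrite IH.
by rewrite -mulr_suml (sum_uniform_weights R (ltn0Sn n'.+1) 0) mul1r.
Qed.

Lemma digit_mean_cvg f : bounded_continuous f ->
  (fun n => digit_mean a unif n.+1 f) @ \oo --> \int[mu]_x f x.
Proof.
move=> fB; have [_ [M fM]] := fB.
(* Adding the bound M makes f nonnegative, as the formula for the finite convolutions requires. *)
have fMB : bounded_continuous (fun x => f x + M).
  by apply: bounded_continuousD => //; exact: bounded_continuous_cst.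
have := mu_conv fMB.1 fMB.2.
have -> : \int[mu]_x (f x + M) = \int[mu]_x f x + M.
  rewrite RintegralD//; [|exact: bounded_continuous_integrable
    |exact/bounded_continuous_integrable/bounded_continuous_cst].
  rewrite Rintegral_cst//; by rewrite [X in fine X](probability_setT mu) mulr1.
have E n : \int[finite_convolution
    (fun k => scale_fset (c k) (to_reals R (digits N (t k)))) n]_x (f x + M) =
    digit_mean a unif n.+1 f + M.
  have fM0 x : 0 <= f x + M by have := fM x; rewrite ler_norml => /andP[]; lra.
  rewrite /Rintegral (integral_finite_convolution N n c0 t0
    (bounded_continuous_measurable fMB) fM0).
  have := digit_mean_lin2 a unif n.+1 1 1 f (fun=> M).
  rewrite digit_mean_cst !mul1r => <-; congr digit_mean.
  by apply/funext => x; rewrite !mul1r.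
under eq_fun do rewrite E.
move=> H; rewrite -[\int[mu]_x f x](addrK M).
rewrite (_ : (fun n => _) = (fun n => digit_mean a unif n.+1 f + M - M)).
  by apply: cvgB H _; exact: cvg_cst.
by apply/funext => n; rewrite addrK.
Qed.

(** If no mask vanished, the finite transforms at l - l' would stay away from 0, yet they converge
    to the inner product. *)
Lemma inner_cexp_eq0_mask (l l' : R) : inner_L2 mu (cexp l) (cexp l') = 0 ->
  exists2 k, (1 <= k)%N & digit_mask a unif k (l - l') == 0.
Proof.
move=> orth; apply: contrapT => nomask.
have nz k : (1 <= k)%N -> digit_mask a unif k (l - l') != 0.
  by move=> k1; apply/negP => m0; apply: nomask; exists k.
have [m [d d0 md]] := uniform_transform_ge (ltn0Sn n'.+1) aK nz.
have [Re0 Im0] : \int[mu]_x complex.Re (cexp (l - l') x) = 0 /\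
                 \int[mu]_x complex.Im (cexp (l - l') x) = 0.
  move: orth; rewrite /inner_L2; under eq_Rintegral do rewrite -cexpB.
  by under [X in (_ +i* X)%C]eq_Rintegral do rewrite -cexpB; case.
have := digit_mean_cvg (bounded_continuous_Re_cexp (l - l')).
rewrite Re0 => cRe.
have := digit_mean_cvg (bounded_continuous_Im_cexp (l - l')).
rewrite Im0 => cIm.
have : (fun n => sqnorm (digit_transform a unif n.+1 (l - l'))) @ \oo --> (0 * 0 + 0 * 0 : R).
  by apply: cvgD; apply: cvgM.
rewrite mul0r addr0 => /cvgr_lt/(_ d d0)[n0 _ H].
have := H (maxn m n0) (leq_maxr _ _) => /=.
by rewrite ltNge md// leqW// leq_maxl.
Qed.

(** Density brings a trigonometric polynomial close to the bump, weak convergence carries this to a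
    finite convolution, and there the bump forbids it. *)
Lemma spectrum_no_colouring (L : set R) (p q : nat) (chi : R -> 'I_N) :
  (1 <= p)%N -> (1 <= q)%N -> p != q -> is_spectrum mu L ->
  ~ (forall l l' k, L l -> L l' -> chi l = chi l' -> (1 <= k)%N ->
       digit_mask a unif k (l - l') = 0 -> k != p /\ k != q).
Proof.
move=> p1 q1 pq [Lorth Ldense] chiP.
have a0 k : (1 <= k)%N -> a k != 0.
  by move=> k1; rewrite mulf_neq0 ?c0 ?intr_eq0 ?t0.
have [g [gcont g01] [e e0 [n0 ge]]] :=
  top_bump_not_approximable n' aK p1 q1 pq (a0 _ p1) (a0 _ q1).
have gB : bounded_continuous g.
  split=> //; exists 1 => x; have /andP[? ?] := g01 x.
  by rewrite ger0_norm.
have zB : bounded_continuous (fun _ : R => 0 : R) by exact: bounded_continuous_cst.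
have gL2 : in_L2 mu (fun x => (g x)%:C%C).
  split.
  - exact: bounded_continuous_measurable.
  - exact: bounded_continuous_measurable.
  - apply: bounded_continuous_integrable.
    by apply: bounded_continuous_sqnorm.
have [r [l [c' [lL dist]]]] := Ldense _ gL2 e e0.
pose F x := (g x)%:C%C - \sum_i c' i * cexp (l i) x.
have FB : bounded_continuous (fun x => sqnorm (F x)).
  have [ReB ImB] := bounded_continuous_trig c' l.
  apply: bounded_continuous_sqnorm; rewrite /F.
    under eq_fun do rewrite raddfB/=.
    by apply: bounded_continuousD => //; exact: bounded_continuousN.
  under eq_fun do rewrite raddfB/=.
  by apply: bounded_continuousD => //; exact: bounded_continuousN.
have intF : \int[mu]_x sqnorm (F x) < e.
  rewrite /Rintegral -lte_fin fineK//.
  by have := integrable_fin_num measurableT (bounded_continuous_integrable mu FB).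
have [n1 _ near1] := cvgr_lt _ (digit_mean_cvg FB) _ intF.
have kex (i : 'I_r * 'I_r) : exists k, (l i.1 != l i.2) ==>
    ((1 <= k)%N && (digit_mask a unif k (l i.1 - l i.2) == 0)).
  case: (eqVneq (l i.1) (l i.2)) => [_|ll]; first by exists 0%N.
  have [k k1 k0] := inner_cexp_eq0_mask (Lorth _ _ (lL i.1) (lL i.2) ll).
  by exists k; rewrite k1 k0.
pose kk i := xchoose (kex i).
(* Only finitely many pairs occur, so one n passes all the indices of their vanishing masks. *)
pose n := maxn n0 (maxn n1 (\max_i kk i)).
have kkP i j : l i != l j ->
    [/\ (1 <= kk (i, j))%N, (kk (i, j) <= n)%N & digit_mask a unif (kk (i, j)) (l i - l j) = 0].
  move=> ll; have /implyP/(_ ll)/andP[k1 /eqP k0] := xchooseP (kex (i, j)).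
  by split=> //; rewrite !leq_max (leq_bigmax (F := kk) (i, j)) !orbT.
have prod0 (w : nat -> 'I_N -> R) k x : (1 <= k)%N -> (k <= n)%N ->
    digit_mask a w k x = 0 -> digit_transform a w n.+1 x = 0.
  move=> k1 kn m0; rewrite digit_transformE; apply/eqP; rewrite prodf_seq_eq0.
  by apply/hasP; exists k; rewrite ?m0 ?eqxx// mem_index_iota k1 ltnS leqW.
have := near1 n; rewrite /= !leq_max leqnn !orbT => /(_ isT).
apply/negP; rewrite -leNgt.
have nn0 : (n0 <= n.+1)%N by rewrite leqW// leq_maxl.
apply: (ge _ nn0 _ c' l chi) => i j ll.
  by have [k1 kn k0] := kkP _ _ ll; exact: prod0 k1 kn k0.
move=> chiij; have [k1 kn k0] := kkP _ _ ll.
have [kp kq] := chiP _ _ _ (lL i) (lL j) chiij k1 k0.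
by apply: prod0 k1 kn _; rewrite corner_mask.
Qed.
End spectrum.

(** * Valuations *)

Section valuations.
Variables (N : nat) (b t : nat -> int).
Hypothesis pN : prime N.
Hypothesis b0 : forall k, (1 <= k)%N -> b k != 0.
Hypothesis t0 : forall k, (1 <= k)%N -> t k != 0.

Let B (k : nat) : int := \prod_(1 <= i < k.+1) b i.
Let s (k : nat) : int := (tau N (B k))%:Z - (tau N (N%:Z * t k))%:Z.

Lemma prodb_neq0 m n : (1 <= m)%N -> \prod_(m <= i < n) b i != 0.
Proof.
move=> m1; rewrite prodf_seq_neq0; apply/allP => i; rewrite mem_index_iota => /andP[mi _].
by rewrite b0// (leq_trans m1).
Qed.

Lemma logn_absz_mul (x y : int) : x != 0 -> y != 0 ->
  logn N `|(x * y)%R| = (logn N `|x| + logn N `|y|)%N.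
Proof. by move=> x0 y0; rewrite abszM lognM ?absz_gt0. Qed.

Lemma valuation_s k : (1 <= k)%N ->
  s k = (logn N `|B k|)%:Z - (logn N `|t k|).+1%:Z.
Proof.
move=> k1; have N0 : N%:Z != 0 by rewrite -lt0n prime_gt0.
rewrite /s !tauE ?mulf_neq0 ?t0 ?prodb_neq0// logn_absz_mul ?t0//.
by rewrite absz_nat (logn_prime N pN) eqxx.
Qed.

(** For fixed n the valuation of the k-th summand is a constant minus s_k, so distinct s_k give
    distinct valuations. *)
Lemma valuation_summand n k : (1 <= k)%N -> (k <= n)%N ->
  (logn N `|((\prod_(k.+1 <= j < n.+1) b j) * t k)%R|)%:Z =
  (logn N `|B n|)%:Z - s k - 1.
Proof.
move=> k1 kn; rewrite valuation_s// logn_absz_mul ?prodb_neq0 ?t0//.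
have -> : B n = B k * \prod_(k.+1 <= j < n.+1) b j by rewrite /B -big_cat_nat.
rewrite logn_absz_mul ?prodb_neq0//; lia.
Qed.

Lemma direct_tile_of_valuations n :
  (forall i j, (1 <= i)%N -> (1 <= j)%N -> i <> j -> s i <> s j) ->
  let A (i : 'I_n) := scale_fset (\prod_((n - i).+1 <= j < n.+1) b j)
                                 (digits N (t (n - i)%N)) in
  direct_sum A /\ integer_tile (sumset A).
Proof.
move=> sI A.
have ni (i : 'I_n) : (1 <= n - i)%N by rewrite subn_gt0.
have g0 (i : 'I_n) : (\prod_((n - i).+1 <= j < n.+1) b j) * t (n - i)%N != 0.
  by rewrite mulf_neq0 ?prodb_neq0 ?t0.
have gI : injective (fun i : 'I_n =>
    logn N `|((\prod_((n - i).+1 <= j < n.+1) b j) * t (n - i)%N)%R|).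
  move=> i j E; apply: contrapT => ij.
  have := @sI (n - i)%N (n - j)%N (ni i) (ni j); apply.
    move=> nij; apply: ij; apply/val_inj => /=.
    by have := ltn_ord i; have := ltn_ord j; lia.
  have := valuation_summand (ni i) (leq_subr i n).
  have := valuation_summand (ni j) (leq_subr j n).
  by rewrite E => -> /eqP; rewrite (inj_eq (addIr _)) (inj_eq (addrI _)) eqr_opp => /eqP.
by split; [exact: scaled_digits_direct | exact: scaled_digits_tile].
Qed.

(** Write y = e N^w with e prime to N: adding y shifts the quotient by e, which changes its residue
    modulo N. *)
Lemma digit_neq (w : nat) (x y : int) : y != 0 -> logn N `|y| = w ->
  ((x + y)%R %/ (N ^ w)%N)%Z <> (x %/ (N ^ w)%N)%Z %[mod N]%Z.
Proof.
move=> y0 yw; have Nw0 : (N ^ w)%N%:Z != 0 by rewrite -lt0n expn_gt0 prime_gt0.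
have /dvdzP[e yE] : ((N ^ w)%N%:Z %| y)%Z by rewrite dvdz_pfactor// yw.
rewrite yE addrC divzMDl// => /eqP; rewrite eqz_mod_dvd addrK => /dvdzP[f fE].
have : ((N ^ w.+1)%N%:Z %| y)%Z.
  by apply/dvdzP; exists f; rewrite yE fE expnS PoszM; ring.
by rewrite dvdz_pfactor// yw ltnn.
Qed.

End valuations.

(** * Zeros of the masks *)

Section masks.
Variables (R : realType) (N : nat) (b t : nat -> int) (M : nat).
Hypothesis pN : prime N.
Hypothesis b2 : forall k, (1 <= k)%N -> 2 <= `|b k|.
Hypothesis t1 : forall k, (1 <= k)%N -> 1 <= `|t k|.
Hypothesis tM : forall k, (1 <= k)%N -> `|t k| <= M%:Z.

Let B (k : nat) : int := \prod_(1 <= i < k.+1) b i.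
Let a (k : nat) : R := \prod_(1 <= i < k.+1) ((b i)%:~R)^-1 * (t k)%:~R.
Let s (k : nat) : int := (tau N (B k))%:Z - (tau N (N%:Z * t k))%:Z.

Let b0 k : (1 <= k)%N -> b k != 0.
Proof. by move=> /b2; case: eqP => // ->. Qed.

Let t0 k : (1 <= k)%N -> t k != 0.
Proof. by move=> /t1; case: eqP => // ->. Qed.

Lemma step_bound k : (1 <= k)%N -> `|a k| <= M%:R / 2 ^+ k.
Proof.
move=> k1; rewrite /a normrM mulrC ler_pM//.
  by rewrite -intr_norm -[M%:R]/(M%:Z%:~R) ler_int tM.
rewrite normr_prod -[X in _ ^+ X]subn0 -(subSS 0 k) -prodr_const_nat -prodfV.
rewrite !big_seq; apply: ler_prod => i; rewrite mem_index_iota => /andP[i1 _].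
rewrite normr_ge0 normfV lef_pV2 ?posrE ?normr_gt0 ?intr_eq0 ?b0//=.
by rewrite -intr_norm -[2]/(2%:~R) ler_int b2.
Qed.

(* All zeros of the masks lie in 1/(N M!) Z: the bound on t gives a common
   denominator for the whole spectrum. *)
Lemma mask_zero_valuation k (x : R) : (1 <= k)%N ->
  digit_mask a (fun _ (_ : 'I_N) => N%:R^-1) k x = 0 ->
  exists d : int, [/\ (N * M`!)%N%:R * x = d%:~R, d != 0 &
    (logn N `|d|)%:Z = (logn N M`!)%:Z + s k + 1].
Proof.
move=> k1; rewrite /digit_mask -mulr_sumr => /eqP.
have N0 : N%:R != 0 :> R by rewrite pnatr_eq0 -lt0n prime_gt0.
rewrite mulf_eq0 eq_complex /= invr_eq0 (negPf N0)/= => /eqP.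
move=> /(sum_cexp_eq0 (prime_gt0 pN))[m xm Nm].
have /dvdzP[u uE] : (t k %| (M`!)%N%:Z)%Z.
  rewrite dvdzE /= dvdn_fact// -!ltz_nat abszE.
  by have := tM k1; have := t1 k1; lia.
have BE : \prod_(1 <= i < k.+1) ((b i)%:~R)^-1 = (B k)%:~R^-1 :> R.
  by rewrite prodfV /B rmorph_prod.
have B0 : B k != 0 by rewrite prodb_neq0.
have B0R : (B k)%:~R != 0 :> R by rewrite intr_eq0.
have xmB : N%:R * x * (t k)%:~R = m%:~R * (B k)%:~R.
  by rewrite -xm /a BE; field.
have m0 : m != 0 by apply: contraNneq Nm => ->; exact: dvdz0.
have u0 : u != 0.
  by apply: contra_eq_neq uE => ->; rewrite mul0r eqz_nat -lt0n fact_gt0.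
(* From M! = u t_k and N x t_k = m B_k; m is prime to N and contributes no valuation. *)
exists (u * m * B k); split.
- rewrite !intrM -mulrA -xmB natrM -[(M`!)%:R]/((M`!)%N%:Z%:~R) uE intrM; ring.
- by rewrite !mulf_neq0.
- have -> : s k = (logn N `|B k|)%:Z - (logn N `|t k|).+1%:Z by exact: valuation_s.
  rewrite !logn_absz_mul ?mulf_neq0//.
  rewrite [logn N `|m|](_ : _ = 0%N); last first.
    apply/eqP; rewrite -leqn0 leqNgt; apply: contra Nm => lm.
    by rewrite -[N]expn1 dvdz_pfactor.
  have := congr1 (fun z : int => logn N `|z|) uE.
  rewrite logn_absz_mul ?t0//= => ->; lia.
Qed.
End masks.

(* Indices start at 1; the values at 0 of b, t, D and s play no role. *)
Theorem theorem1p3 (R : realType) (N : nat) (b t : nat -> int)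
    (mu : probability (measurableTypeR R) R) :
  prime N ->
  (forall k, (1 <= k)%N -> 2 <= `|b k|) ->
  (exists M : int, forall k, (1 <= k)%N -> `|t k| <= M) ->
  (forall k, (1 <= k)%N -> 1 <= `|t k|) ->
  let D (k : nat) : {fset int} := digits N (t k) in
  let s (k : nat) : int :=
    (tau N (\prod_(1 <= i < k.+1) b i))%:Z - (tau N (N%:Z * t k))%:Z in
  is_infinite_convolution
    (fun k => scale_fset (\prod_(1 <= i < k.+1) ((b i)%:~R)^-1)
                         (to_reals R (D k)))
    mu ->
  spectral_measure mu ->
  (forall i j, (1 <= i)%N -> (1 <= j)%N -> i <> j -> s i <> s j) /\
  (forall n, (1 <= n)%N ->
     (* The i-th summand, for i = 0, ..., n - 1, is b_n ... b_{k+1} D_k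
        where k = n - i. *)
     let A (i : 'I_n) : {fset int} :=
       scale_fset (\prod_((n - i).+1 <= j < n.+1) b j) (D (n - i)%N) in
     direct_sum A /\ integer_tile (sumset A)).
Proof.
move=> pN b2 [M tM] t1 D s mu_conv [_ [L L_spectrum]].
have b0 k : (1 <= k)%N -> b k != 0 by move=> /b2; case: eqP => // ->.
have t0 k : (1 <= k)%N -> t k != 0 by move=> /t1; case: eqP => // ->.
have sI i j : (1 <= i)%N -> (1 <= j)%N -> i <> j -> s i <> s j.
  move=> i1 j1 /eqP ij sij.
  have {}tM k : (1 <= k)%N -> `|t k| <= `|M|%N%:Z.
    by move=> /tM; lia.
  have aK := step_bound R b2 tM.
  have val := @mask_zero_valuation R N b t `|M| pN b2 t1 tM.
  have c0 k : (1 <= k)%N -> \prod_(1 <= i < k.+1) ((b i)%:~R)^-1 != 0 :> R.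
    move=> k1; rewrite prodfV invr_eq0 -rmorph_prod intr_eq0.
    by rewrite (prodb_neq0 b0).
  (* The valuation of N M! (l - l') whenever a mask k with s_k = s_i vanishes at l - l'. *)
  pose w := `|((logn N (absz M)`!)%:Z + s i + 1)%R|%N.
  (* Only differences of frequencies are rational; the floor makes the digit meaningful for each l
     and commutes with integer shifts. *)
  pose dig (l : R) := ((Num.floor ((N * (absz M)`!)%N%:R * l) %/ (N ^ w)%N)%Z %% N)%Z.
  have N0 : (0 < N)%N by exact: prime_gt0.
  have digN l : (`|dig l| < N)%N.
    by rewrite -ltz_nat gez0_abs ?modz_ge0 ?ltz_pmod// -lt0n.
  have change l l' k : (1 <= k)%N -> s k = s i ->
      digit_mask (fun k => \prod_(1 <= i < k.+1) ((b i)%:~R)^-1 * (t k)%:~R)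
        (fun _ (_ : 'I_N) => N%:R^-1) k (l - l') = 0 ->
      Ordinal (digN l) <> Ordinal (digN l').
    move=> k1 ski /(val _ _ k1)[d [dE d0 dv]] [] /(congr1 Posz).
    rewrite !gez0_abs ?modz_ge0 -?lt0n// /dig.
    have -> : (N * (absz M)`!)%N%:R * l = (N * (absz M)`!)%N%:R * l' + d%:~R.
      by rewrite -dE; ring.
    rewrite floorDrz ?intr_int// intrKfloor.
    by apply: digit_neq => //; rewrite /w -ski -dv absz_nat.
  have [n' NE] : exists n', N = n'.+2 by case: (N) pN => [|[|n']] //; exists n'.
  clear -NE c0 t0 aK mu_conv L_spectrum i1 j1 ij sij change; subst N.
  apply: (@spectrum_no_colouring R n' _ t _ c0 t0 aK mu mu_conv L i j
    (fun l => Ordinal (digN l)) i1 j1 ij L_spectrum) => l l' k _ _ ll k1 k0.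
  split; apply/eqP => kE; subst k.
    exact: change k1 erefl k0 ll.
  exact: change k1 (esym sij) k0 ll.
split=> // n n1; exact: direct_tile_of_valuations.
Qed.
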